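(* For every integer $k\ge 3$, \[\overline{\alpha}(\{1,k,k+3\})=\begin{cases}\frac{2k+5}{5k+20} & k\equiv 0\pmod 5,\\ \frac25 & k\equiv 1\pmod 5,\\ \frac{2k+6}{5k+20} & k\equiv 2\pmod 5,\\ \frac{4k+3}{10k+15} & k\equiv 3\pmod 5,\\ \frac{2k+7}{5k+20} & k\equiv 4\pmod 5.\end{cases}\]
   Context: For a finite set $S$ of positive integers, the distance graph $G(S)$ has vertex set $\mathbb{Z}$, with $i,j$ adjacent iff $|i-j|\in S$. The density of $A\subseteq\mathbb{Z}$ is $\delta(A)=\limsup_{N\to\infty}\frac{|A\cap[-N,N]|}{2N+1}$, and the independence ratio $\overline{\alpha}(S)$ is the supremum of $\delta(A)$ over independent sets $A$ of $G(S)$. *)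

(* Defs.v *)
From Stdlib Require Import Reals ZArith List.
From Coquelicot Require Import Coquelicot.
Open Scope R_scope.

(* A finite set S of positive integers is given as a list of positive integers. *)
(* Subsets of Z are represented by boolean predicates (classically equivalent). *)

Definition independent (S : list Z) (A : Z -> bool) : Prop :=
  forall i j : Z, A i = true -> A j = true -> ~ In (Z.abs (i - j)) S.

Definition count_in (A : Z -> bool) (N : nat) : nat :=
  length (filter A (map (fun k : nat => (Z.of_nat k - Z.of_nat N)%Z)
                        (seq 0 (2 * N + 1)))).

Definition density_ratio (A : Z -> bool) (N : nat) : R :=
  INR (count_in A N) / INR (2 * N + 1).

(* upper density δ(A) = limsup_{N→∞} |A ∩ [-N,N]| / (2N+1)
   (the sequence lies in [0,1], so the limsup is a finite real) *)
Definition density (A : Z -> bool) : R := real (LimSup_seq (density_ratio A)).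

Definition is_indep_ratio (S : list Z) (r : R) : Prop :=
  is_lub (fun d : R => exists A : Z -> bool, independent S A /\ d = density A) r.

(* Main.v *)
(** For every [x] the vertices [x, x+1, x+2, x+3, x+k+3] and
    [x, x+k, x+k+1, x+k+2, x+k+3] form 5-cycles, so each of them misses the bound
    2 by a nonnegative deficiency.  The sum of both deficiencies is a function
    [cost] of the "state" of [A] at [x], which is the pair of words
    [A x .. A (x+3)] and [A (x+k) .. A (x+k+3)]; only 37 states occur.
    Moving [x] one step to the right changes the state by shifting in one column, and
    after [k] steps the first word equals the second word of the starting
    state.  Since a walk of cost 0 is 5-periodic, the minimal cost of a walk of
    [k] steps between two given states can be bounded in terms of [k mod 5] alone,
    by a finite min-plus computation.  Going through [k+4] steps (or [2k+3]
    when [k = 3 mod 5]) this yields, up to a potential depending on the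
    state, a total cost of at least [2 K] with [K = 3, 2, 3, 1] for
    [k = 0, 2, 3, 4 mod 5], and averaging the cost gives the upper bound; for
    [k = 1 mod 5] it is enough that the cost is nonnegative.
    The extremal sets are rotation sets [{x | t x mod n < a}] with [n = k+4]
    or [n = 2k+3]. *)
Require Import Defs.
From Stdlib Require Import Reals ZArith List.
From Stdlib Require Import Bool Lia Lra.
From Coquelicot Require Import Coquelicot.
Import ListNotations.
Open Scope Z_scope.

(** * Min-plus computations on states *)

(* A state lists its four columns [(A (x+i), A (x+k+i))], [i < 4]. *)
Notation state := (list (bool * bool)).

(** A quaternary trie branching on one column per level. Storing every intermediate function as a
    table keeps nested minimisations from being recomputed at each call. *)
Inductive tree := Leaf (z : Z) | Node (a b c d : tree).

Fixpoint lookup (t : tree) (s : state) : Z :=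
  match t, s with
  | Leaf z, _ => z
  | Node a b c d, (p, q) :: s' =>
      lookup (if p then if q then d else c else if q then b else a) s'
  | Node _ _ _ _, [] => 0
  end.

Fixpoint tabulate (n : nat) (f : state -> Z) : tree :=
  match n with
  | O => Leaf (f [])
  | S m => Node (tabulate m (fun s => f ((false, false) :: s)))
                (tabulate m (fun s => f ((false, true) :: s)))
                (tabulate m (fun s => f ((true, false) :: s)))
                (tabulate m (fun s => f ((true, true) :: s)))
  end.

Lemma lookup_tabulate (f : state -> Z) (s : state) :
  lookup (tabulate (length s) f) s = f s.
Proof.
  revert f; induction s as [|[p q] s IH]; intros f; [reflexivity|].
  destruct p, q; simpl; apply IH.
Qed.

Definition table : (state -> Z) -> tree := tabulate 4.

Definition columns : list (bool * bool) := list_prod [false; true] [false; true].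

Fixpoint tuples (n : nat) : list state :=
  match n with
  | O => [[]]
  | S m => map (fun cs => fst cs :: snd cs) (list_prod columns (tuples m))
  end.

Definition admissible (s : state) : bool :=
  match s with
  | [(p0, q0); (p1, q1); (p2, q2); (p3, q3)] =>
      negb (p0 && q0 || p1 && q1 || p2 && q2 || p3 && q3 || p0 && q3
            || p0 && p1 || p1 && p2 || p2 && p3 || q0 && q1 || q1 && q2 || q2 && q3)
  | _ => false
  end.

Definition states : list state := filter admissible (tuples 4).

Definition rows : list (list bool) :=
  nodup (list_eq_dec bool_dec) (map (map snd) states).

Definition cost (s : state) : Z :=
  match s with
  | [(p0, q0); (p1, q1); (p2, q2); (p3, q3)] =>
      4 - (Z.b2z p0 + Z.b2z p1 + Z.b2z p2 + Z.b2z p3 + Z.b2z q3)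
        - (Z.b2z p0 + Z.b2z q0 + Z.b2z q1 + Z.b2z q2 + Z.b2z q3)
  | _ => 0
  end.

(* Plays the role of infinity; soundness does not depend on its value. *)
Definition big : Z := 100.

(** A moving window drops its first column, so the predecessors of [t] are the states [[x; a; b; c]]
    with [x] free; the cost is charged to the state that is left. *)
Definition pull (v : state -> Z) (t : state) : Z :=
  match t with
  | [a; b; c; _] =>
      if admissible t then
        fold_right Z.min big
          (map (fun x => v [x; a; b; c] + cost [x; a; b; c]) columns)
      else big
  | _ => big
  end.

Definition push (v : tree) : tree := table (pull (lookup v)).

Definition shift (c : Z) (v : tree) : tree := table (fun s => c + lookup v s).

Definition tmin (v w : tree) : tree :=
  table (fun s => Z.min (lookup v s) (lookup w s)).

Definition tle (v w : tree) : bool :=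
  forallb (fun s => lookup v s <=? lookup w s) states.

Definition row_eqb (q r : list bool) : bool :=
  if list_eq_dec bool_dec q r then true else false.

Definition start (psi : tree) (q : list bool) : tree :=
  table (fun s => if row_eqb (map snd s) q then lookup psi s else big).

(* Lower bounds for the cost of the walks of length divisible by 5 that start in
   a state with second row [q]; two rounds of relaxation reach the fixpoint. *)
Definition closure (psi : tree) (q : list bool) : tree :=
  Nat.iter 2 (fun v => tmin v (Nat.iter 5 push v)) (start psi q).

(** If five more pushes nowhere lower the closure, then by induction it is a lower bound after every
    multiple of 5 steps, so [k] enters only through its residue. *)
Definition closed (psi : tree) : bool :=
  forallb (fun q => tle (closure psi q) (Nat.iter 5 push (closure psi q))) rows.

(* The state reached after [k] steps, where [j = k mod 5], has as first row the
   second row of the starting state. *)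
Definition walk (j : nat) (psi : tree) : tree :=
  let vs := map (fun q => (q, Nat.iter j push (closure psi q))) rows in
  table (fun t =>
    match find (fun qv => row_eqb (map fst t) (fst qv)) vs with
    | Some qv => lookup (snd qv) t
    | None => 0
    end).

(* [w] walks of [k] steps followed by [s] single steps. *)
Definition tour (j w s : nat) (psi : tree) : tree :=
  Nat.iter s push (Nat.iter w (walk j) psi).

Fixpoint all_closed (j w : nat) (psi : tree) : bool :=
  match w with
  | O => true
  | S w' => all_closed j w' psi && closed (Nat.iter w' (walk j) psi)
  end.

(** Value iteration towards a potential with [psi + 2 * K <= tour psi]: each round lowers [psi]
    where this fails. That two rounds suffice is checked by [certified]. *)
Definition potential (j w s : nat) (K : Z) : tree :=
  Nat.iter 2 (fun psi => tmin psi (shift (- (2 * K)) (tour j w s psi)))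
    (table (fun s => if admissible s then 0 else big)).

Definition certified (j w s : nat) (K : Z) (psi : tree) : bool :=
  all_closed j w psi && tle (shift (2 * K) psi) (tour j w s psi)
  && tle (Leaf (- big)) psi && tle psi (Leaf big).

Lemma certified_potentials :
  certified 0 1 4 3 (potential 0 1 4 3) = true /\
  certified 1 0 1 0 (potential 1 0 1 0) = true /\
  certified 2 1 4 2 (potential 2 1 4 2) = true /\
  certified 3 2 3 3 (potential 3 2 3 3) = true /\
  certified 4 1 4 1 (potential 4 1 4 1) = true.
Proof. vm_compute; repeat split. Qed.

(** * Soundness for sets without differences 1, k, k + 3 *)

Definition sparse (A : Z -> bool) (k : Z) : Prop :=
  forall i j, j = i + 1 \/ j = i + k \/ j = i + (k + 3) ->
    A i && A j = false.

Definition win (A : Z -> bool) (k x : Z) : state :=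
  map (fun i => (A (x + i), A (x + k + i))) [0; 1; 2; 3].

Lemma win_admissible (A : Z -> bool) (k x : Z) :
  sparse A k -> admissible (win A k x) = true.
Proof.
  intros hA.
  cbv [win map admissible].
  rewrite !hA; [reflexivity|lia..].
Qed.

Lemma in_tuples (s : state) : In s (tuples (length s)).
Proof.
  induction s as [|[p q] s IH]; [left; reflexivity|].
  cbn [length tuples].
  apply in_map_iff; exists ((p, q), s); split; [reflexivity|].
  apply in_prod; [destruct p, q; simpl; tauto|exact IH].
Qed.

Lemma in_states (s : state) : length s = 4%nat -> admissible s = true -> In s states.
Proof.
  intros hl hs; apply filter_In; split; [|exact hs].
  rewrite <- hl; apply in_tuples.
Qed.

Lemma win_states (A : Z -> bool) (k x : Z) : sparse A k -> In (win A k x) states.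
Proof. intros hA; apply in_states; [reflexivity|now apply win_admissible]. Qed.

Lemma lookup_table (f : state -> Z) (A : Z -> bool) (k x : Z) :
  lookup (table f) (win A k x) = f (win A k x).
Proof. apply (lookup_tabulate f (win A k x)). Qed.

Lemma win_row (A : Z -> bool) (k x : Z) :
  map fst (win A k (x + k)) = map snd (win A k x).
Proof. reflexivity. Qed.

Lemma row_eqb_eq (q r : list bool) : row_eqb q r = true <-> q = r.
Proof. unfold row_eqb; destruct (list_eq_dec bool_dec q r); split; congruence. Qed.

Lemma tle_win (v w : tree) (A : Z -> bool) (k x : Z) :
  sparse A k -> tle v w = true -> lookup v (win A k x) <= lookup w (win A k x).
Proof.
  intros hA h; apply Z.leb_le.
  exact (proj1 (forallb_forall _ _) h _ (win_states A k x hA)).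
Qed.

Lemma fold_min_le (z : Z) (l : list Z) (b : Z) : In z l -> fold_right Z.min b l <= z.
Proof.
  induction l as [|y l IH]; simpl; [tauto|].
  intros [->|h]; [lia|specialize (IH h); lia].
Qed.

Lemma push_win (v : tree) (A : Z -> bool) (k x : Z) :
  sparse A k ->
  lookup (push v) (win A k (x + 1)) <= lookup v (win A k x) + cost (win A k x).
Proof.
  intros hA.
  unfold push; rewrite lookup_table.
  assert (h : win A k (x + 1) =
    tl (win A k x) ++ [(A (x + 1 + 3), A (x + 1 + k + 3))]).
  { cbv [win map tl app].
    repeat (apply (f_equal2 cons); [apply f_equal2; f_equal; lia|]); reflexivity. }
  pose proof (win_admissible A k (x + 1) hA) as ha.
  rewrite h in ha |- *.
  unfold win in ha |- *; cbn [map tl app] in ha |- *; unfold pull; rewrite ha.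
  apply fold_min_le, in_map_iff.
  eexists; split; [reflexivity|].
  destruct (A (x + 0)), (A (x + k + 0)); simpl; tauto.
Qed.

(** Only the increments of the running total are fixed, so it may be shifted by a constant or given
    by a closed formula in counts of [A]. *)
Definition totals_cost (A : Z -> bool) (k x0 : Z) (C : Z -> Z) : Prop :=
  forall y, x0 <= y -> C (y + 1) = C y + cost (win A k y).

Lemma iter_push_win (n : nat) (v : tree) (A : Z -> bool) (k x0 x : Z) (C : Z -> Z) :
  sparse A k -> totals_cost A k x0 C -> x0 <= x ->
  lookup v (win A k x) <= C x ->
  lookup (Nat.iter n push v) (win A k (x + Z.of_nat n)) <= C (x + Z.of_nat n).
Proof.
  intros hA hC hx hv; induction n as [|n IH].
  - now rewrite Z.add_0_r.
  - replace (x + Z.of_nat (S n)) with (x + Z.of_nat n + 1) by lia.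
    rewrite hC by lia; cbn [Nat.iter].
    pose proof (push_win (Nat.iter n push v) A k (x + Z.of_nat n) hA); simpl in *; lia.
Qed.

Lemma win_rows (A : Z -> bool) (k x : Z) : sparse A k -> In (map snd (win A k x)) rows.
Proof. intros hA; apply nodup_In, in_map, win_states, hA. Qed.

Lemma tmin_win (v w : tree) (A : Z -> bool) (k x : Z) :
  lookup (tmin v w) (win A k x) <= lookup v (win A k x).
Proof. unfold tmin; rewrite lookup_table; apply Z.le_min_l. Qed.

Lemma closure_win (psi : tree) (A : Z -> bool) (k x : Z) :
  lookup (closure psi (map snd (win A k x))) (win A k x) <= lookup psi (win A k x).
Proof.
  eapply Z.le_trans; [apply tmin_win|].
  eapply Z.le_trans; [apply tmin_win|].
  unfold start; rewrite lookup_table.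
  now rewrite (proj2 (row_eqb_eq _ _) eq_refl).
Qed.

Opaque states rows push closure.

Lemma closed_win (m : nat) (v : tree) (A : Z -> bool) (k x0 x : Z) (C : Z -> Z) :
  sparse A k -> totals_cost A k x0 C -> x0 <= x ->
  tle v (Nat.iter 5 push v) = true ->
  lookup v (win A k x) <= C x ->
  lookup v (win A k (x + Z.of_nat (5 * m))) <= C (x + Z.of_nat (5 * m)).
Proof.
  intros hA hC hx hcl hv; induction m as [|m IH].
  - now rewrite Z.add_0_r.
  - replace (x + Z.of_nat (5 * S m)) with (x + Z.of_nat (5 * m) + Z.of_nat 5) by lia.
    eapply Z.le_trans; [apply tle_win; [exact hA|exact hcl]|].
    apply iter_push_win with x0; trivial; lia.
Qed.

(** The walk splits into [5 * m] steps, covered by the closure, and [j] pushes. The final state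
    tells which closure to use, its first row being the second row at [x]. *)
Lemma walk_win (j m : nat) (psi : tree) (A : Z -> bool) (k x0 x : Z) (C : Z -> Z) :
  sparse A k -> totals_cost A k x0 C -> x0 <= x ->
  k = Z.of_nat (5 * m + j) -> closed psi = true ->
  lookup psi (win A k x) <= C x ->
  lookup (walk j psi) (win A k (x + k)) <= C (x + k).
Proof.
  intros hA hC hx hk hcl hpsi.
  pose proof (win_rows A k x hA) as hrow.
  assert (hreach : forall q, q = map snd (win A k x) ->
    lookup (Nat.iter j push (closure psi q)) (win A k (x + k)) <= C (x + k)).
  { intros q hq.
    replace (x + k) with (x + Z.of_nat (5 * m) + Z.of_nat j) by lia.
    apply iter_push_win with x0; trivial; [lia|].
    apply closed_win with x0; trivial.
    - subst q; exact (proj1 (forallb_forall _ _) hcl _ hrow).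
    - subst q; apply Z.le_trans with (2 := hpsi), closure_win. }
  unfold walk; rewrite lookup_table, win_row.
  destruct (find _ _) as [qv|] eqn:hf.
  - apply find_some in hf; destruct hf as [hin hq].
    apply in_map_iff in hin; destruct hin as [q [<- _]].
    apply row_eqb_eq in hq; simpl in *.
    apply hreach; auto.
  - exfalso.
    pose proof (find_none _ _ hf _
      (in_map (fun q => (q, Nat.iter j push (closure psi q))) _ _ hrow)) as hn.
    cbn [fst] in hn.
    rewrite (proj2 (row_eqb_eq _ _) eq_refl) in hn; discriminate hn.
Qed.

Opaque walk.

Lemma tour_win (j w s m : nat) (psi : tree) (A : Z -> bool) (k x0 x : Z) (C : Z -> Z) :
  sparse A k -> totals_cost A k x0 C -> x0 <= x ->
  k = Z.of_nat (5 * m + j) -> all_closed j w psi = true ->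
  lookup psi (win A k x) <= C x ->
  lookup (tour j w s psi) (win A k (x + (Z.of_nat w * k + Z.of_nat s)))
    <= C (x + (Z.of_nat w * k + Z.of_nat s)).
Proof.
  intros hA hC hx hk hcl hpsi.
  rewrite Z.add_assoc; apply iter_push_win with x0; trivial; [nia|].
  induction w as [|w IH].
  - now rewrite Z.add_0_r.
  - cbn [all_closed] in hcl; apply andb_true_iff in hcl; destruct hcl as [h1 h2].
    replace (x + Z.of_nat (S w) * k) with (x + Z.of_nat w * k + k) by lia.
    cbn [Nat.iter].
    apply walk_win with m x0; trivial; [nia|auto].
Qed.

(** Each tour raises the total by at least [2 * K] plus the change of potential. These changes
    telescope, and [psi] stays between [- big] and [big], hence the error [2 * big]. *)
Lemma certified_win (j w s m q : nat) (K : Z) (psi : tree)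
    (A : Z -> bool) (k x0 : Z) (C : Z -> Z) :
  sparse A k -> totals_cost A k x0 C ->
  k = Z.of_nat (5 * m + j) -> certified j w s K psi = true ->
  C x0 + 2 * K * Z.of_nat q
    <= C (x0 + Z.of_nat q * (Z.of_nat w * k + Z.of_nat s)) + 2 * big.
Proof.
  intros hA hC hk hcert.
  unfold certified in hcert; rewrite !andb_true_iff in hcert.
  destruct hcert as [[[hcl hle] hlo] hhi].
  set (p := Z.of_nat w * k + Z.of_nat s).
  assert (hp : 0 <= p).
  { pose proof (Z.mul_nonneg_nonneg (Z.of_nat w) k); unfold p; lia. }
  assert (h : lookup psi (win A k (x0 + Z.of_nat q * p)) <=
    C (x0 + Z.of_nat q * p) - C x0 + big - 2 * K * Z.of_nat q).
  { induction q as [|q IH].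
    - rewrite Z.add_0_r.
      pose proof (tle_win _ _ A k x0 hA hhi) as h;
      cbn [lookup] in h; lia.
    - set (y := x0 + Z.of_nat q * p) in *.
      replace (x0 + Z.of_nat (S q) * p) with (y + p) by (unfold y; lia).
      pose proof (tle_win _ _ A k (y + p) hA hle) as h.
      unfold shift in h; rewrite lookup_table in h.
      (* With the total shifted by this constant, the premise on [psi] at [y] is the induction
         hypothesis. *)
      pose proof (tour_win j w s m psi A k x0 y
        (fun z => C z - C x0 + big - 2 * K * Z.of_nat q) hA) as ht.
      fold p in ht; cbv beta in ht.
      assert (lookup (tour j w s psi) (win A k (y + p)) <=
        C (y + p) - C x0 + big - 2 * K * Z.of_nat q); [|lia].
      apply ht; trivial.
      + intros z hz; cbv beta; specialize (hC z hz); lia.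
      + unfold y; nia. }
  pose proof (tle_win _ _ A k (x0 + Z.of_nat q * p) hA hlo) as hb;
    cbn [lookup] in hb; lia.
Qed.

(** * Counting *)

Definition count_from (A : Z -> bool) (x : Z) (n : nat) : nat :=
  length (filter A (map (fun i => x + Z.of_nat i) (seq 0 n))).

Lemma count_from_S (A : Z -> bool) (x : Z) (n : nat) :
  Z.of_nat (count_from A x (S n)) =
  Z.of_nat (count_from A x n) + Z.b2z (A (x + Z.of_nat n)).
Proof.
  unfold count_from; rewrite seq_S, map_app, filter_app, length_app; simpl.
  destruct (A (x + Z.of_nat n)); simpl; lia.
Qed.

Lemma count_in_from (A : Z -> bool) (N : nat) :
  count_in A N = count_from A (- Z.of_nat N) (2 * N + 1).
Proof.
  unfold count_in, count_from; do 2 f_equal.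
  apply map_ext; intros i; lia.
Qed.

Lemma count_from_add (A : Z -> bool) (x : Z) (m n : nat) :
  Z.of_nat (count_from A x m) <= Z.of_nat (count_from A x (m + n))
    <= Z.of_nat (count_from A x m) + Z.of_nat n.
Proof.
  induction n as [|n IH]; [rewrite Nat.add_0_r; lia|].
  rewrite Nat.add_succ_r, count_from_S.
  destruct (A (x + Z.of_nat (m + n))); simpl; lia.
Qed.

Lemma certified_count (j w s m q : nat) (K : Z) (psi : tree)
    (A : Z -> bool) (k x : Z) :
  0 <= k -> sparse A k ->
  k = Z.of_nat (5 * m + j) -> certified j w s K psi = true ->
  10 * Z.of_nat (count_from A x (q * Z.to_nat (Z.of_nat w * k + Z.of_nat s)))
    <= (4 * (Z.of_nat w * k + Z.of_nat s) - 2 * K) * Z.of_nat q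
       + (10 * (k + 3) + 2 * big).
Proof.
  intros hk0 hA hk hcert.
  set (p := Z.of_nat w * k + Z.of_nat s).
  set (F := fun y => Z.of_nat (count_from A x (Z.to_nat (y - x)))).
  assert (hF : forall y, x <= y -> F (y + 1) = F y + Z.b2z (A y)).
  { intros y hy; unfold F.
    replace (Z.to_nat (y + 1 - x)) with (S (Z.to_nat (y - x))) by lia.
    rewrite count_from_S; do 3 f_equal; lia. }
  assert (hFadd : forall y d, x <= y -> 0 <= d -> F y <= F (y + d) <= F y + d).
  { intros y d hy hd; unfold F.
    replace (Z.to_nat (y + d - x)) with (Z.to_nat (y - x) + Z.to_nat d)%nat by lia.
    pose proof (count_from_add A x (Z.to_nat (y - x)) (Z.to_nat d)); lia. }
  assert (hFx : F x = 0) by (unfold F; now rewrite Z.sub_diag).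
  (* One translate of the counting function for each vertex of the two 5-cycles at [y], so that the
     increments of [C] are the costs. *)
  set (C := fun y => 4 * y
    - (F (y + 0) + F (y + 1) + F (y + 2) + F (y + 3) + F (y + k + 3))
    - (F (y + 0) + F (y + k + 0) + F (y + k + 1) + F (y + k + 2) + F (y + k + 3))).
  assert (hC : totals_cost A k x C).
  { intros y hy; unfold C, win; cbn [map cost].
    replace (y + 1 + 0) with (y + 0 + 1) by lia.
    replace (y + 1 + 2) with (y + 2 + 1) by lia.
    replace (y + 1 + 3) with (y + 3 + 1) by lia.
    replace (y + 1 + k + 3) with (y + k + 3 + 1) by lia.
    replace (y + 1 + k + 0) with (y + k + 0 + 1) by lia.
    replace (y + 1 + k + 1) with (y + k + 1 + 1) by lia.
    replace (y + 1 + k + 2) with (y + k + 2 + 1) by lia.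
    rewrite !hF by lia; lia. }
  pose proof (certified_win j w s m q K psi A k x C hA hC hk hcert) as h.
  fold p in h.
  assert (hp : 0 <= p) by (unfold p; nia).
  set (y := x + Z.of_nat q * p) in *.
  assert (hy : x <= y) by (unfold y; nia).
  replace (count_from A x (q * Z.to_nat p))
    with (count_from A x (Z.to_nat (y - x))) by (f_equal; unfold y; nia).
  fold (F y).
  (* At [x] each of the ten counts is at most [k + 3]; at [y], by monotonicity, each is at least
     [F y]. *)
  assert (hlo : 4 * x - 10 * (k + 3) <= C x).
  { unfold C; rewrite <- !Z.add_assoc.
    pose proof (hFadd x 0); pose proof (hFadd x 1); pose proof (hFadd x 2).
    pose proof (hFadd x 3); pose proof (hFadd x (k + 0)); pose proof (hFadd x (k + 1)).
    pose proof (hFadd x (k + 2)); pose proof (hFadd x (k + 3)); lia. }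
  assert (hhi : C y <= 4 * y - 10 * F y).
  { unfold C; rewrite <- !Z.add_assoc.
    pose proof (hFadd y 0); pose proof (hFadd y 1); pose proof (hFadd y 2).
    pose proof (hFadd y 3); pose proof (hFadd y (k + 0)); pose proof (hFadd y (k + 1)).
    pose proof (hFadd y (k + 2)); pose proof (hFadd y (k + 3)); lia. }
  unfold y in hhi at 2; lia.
Qed.

(** * Densities *)

Open Scope R_scope.

Lemma density_ratio_bounds (A : Z -> bool) (N : nat) : 0 <= density_ratio A N <= 1.
Proof.
  assert (hpos : 0 < INR (2 * N + 1)) by (apply lt_0_INR; lia).
  assert (h : (count_in A N <= 2 * N + 1)%nat).
  { unfold count_in; rewrite filter_length_le, length_map, length_seq; lia. }
  unfold density_ratio; split.
  - apply Rdiv_le_0_compat; [apply pos_INR|exact hpos].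
  - apply Rmult_le_reg_r with (1 := hpos); field_simplify; [|lra].
    now apply le_INR.
Qed.

(** [real] would turn an infinite limsup into 0; ratios in [[0, 1]] exclude this. *)
Lemma LimSup_density (A : Z -> bool) : LimSup_seq (density_ratio A) = Finite (density A).
Proof.
  assert (h0 : Rbar_le 0 (LimSup_seq (density_ratio A))).
  { rewrite <- (LimSup_seq_const 0).
    apply LimSup_le; exists 0%nat; intros n _; apply density_ratio_bounds. }
  assert (h1 : Rbar_le (LimSup_seq (density_ratio A)) 1).
  { rewrite <- (LimSup_seq_const 1).
    apply LimSup_le; exists 0%nat; intros n _; apply density_ratio_bounds. }
  unfold density; destruct (LimSup_seq (density_ratio A)); simpl in *; tauto.
Qed.

Lemma eventually_small (M eps : R) :
  0 < eps -> eventually (fun N => M <= eps * INR (2 * N + 1)).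
Proof.
  intros heps.
  destruct (INR_archimed (eps / 2) M) as [N0 hN0]; [lra|].
  exists N0; intros N hN.
  apply le_INR, (Rmult_le_compat_l eps) in hN; [|lra].
  assert (0 <= eps * INR N0) by (apply Rmult_le_pos; [lra|apply pos_INR]).
  rewrite plus_INR, mult_INR; simpl (INR 2); simpl (INR 1); lra.
Qed.

Lemma density_le (A : Z -> bool) (r M : R) :
  (forall N, INR (count_in A N) <= r * INR (2 * N + 1) + M) -> density A <= r.
Proof.
  intros h; apply le_epsilon; intros eps heps.
  change (Rbar_le (Finite (density A)) (Finite (r + eps))).
  rewrite <- LimSup_density, <- (LimSup_seq_const (r + eps)); apply LimSup_le.
  destruct (eventually_small M eps heps) as [N0 hN0].
  exists N0; intros N hN; specialize (hN0 N hN); specialize (h N).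
  assert (hpos : 0 < INR (2 * N + 1)) by (apply lt_0_INR; lia).
  unfold density_ratio; apply Rle_div_l; lra.
Qed.

Lemma le_density (A : Z -> bool) (r M : R) :
  (forall N, r * INR (2 * N + 1) <= INR (count_in A N) + M) -> r <= density A.
Proof.
  intros h; apply le_epsilon; intros eps heps.
  cut (r - eps <= density A); [lra|].
  change (Rbar_le (Finite (r - eps)) (Finite (density A))).
  rewrite <- LimSup_density, <- (LimSup_seq_const (r - eps)); apply LimSup_le.
  destruct (eventually_small M eps heps) as [N0 hN0].
  exists N0; intros N hN; specialize (hN0 N hN); specialize (h N).
  assert (hpos : 0 < INR (2 * N + 1)) by (apply lt_0_INR; lia).
  unfold density_ratio; apply Rle_div_r; lra.
Qed.

Lemma independent_sparse (A : Z -> bool) (k : Z) :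
  (0 <= k)%Z -> independent [1; k; k + 3]%Z A <-> sparse A k.
Proof.
  intros hk; split.
  - intros h i j hij.
    destruct (A i) eqn:hi, (A j) eqn:hj; trivial.
    exfalso; apply (h i j hi hj); simpl; lia.
  - intros h i j hi hj hin; simpl in hin.
    destruct (Z.le_ge_cases i j).
    + specialize (h i j); rewrite hi, hj in h; discriminate h; lia.
    + specialize (h j i); rewrite hi, hj in h; discriminate h; lia.
Qed.

Lemma certified_density (j w s m : nat) (K : Z) (psi : tree) (A : Z -> bool) (k p : Z) :
  (0 <= k)%Z -> independent [1; k; k + 3]%Z A ->
  k = Z.of_nat (5 * m + j) -> certified j w s K psi = true ->
  p = (Z.of_nat w * k + Z.of_nat s)%Z -> (0 < p)%Z -> (K <= 2 * p)%Z ->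
  density A <= (2 * IZR p - IZR K) / (5 * IZR p).
Proof.
  intros hk0 hA hk hcert hp hp0 hK.
  apply independent_sparse in hA; [|exact hk0].
  assert (hp0' : 0 < IZR p) by now apply IZR_lt.
  assert (hK' : IZR K <= 2 * IZR p) by (rewrite <- mult_IZR; now apply IZR_le).
  set (D := IZR (10 * (k + 3) + 2 * big)).
  apply density_le with ((4 * IZR p - 2 * IZR K + D) / 10); intros N.
  set (L := (2 * N + 1)%nat).
  (* One tour more than the quotient, so that the tours cover all of [[-N, N]]; the overshoot of at
     most [p] only affects the constant. *)
  set (q := (L / Z.to_nat p + 1)%nat).
  pose proof (Nat.div_mod L (Z.to_nat p)) as hdiv.
  pose proof (Nat.mod_upper_bound L (Z.to_nat p)) as hmod.
  pose proof (certified_count j w s m q K psi A k (- Z.of_nat N) hk0 hA hk hcert) as h.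
  rewrite <- hp in h.
  assert (hL : (L <= q * Z.to_nat p)%nat) by (unfold q; nia).
  assert (hq : (Z.of_nat q * p <= Z.of_nat L + p)%Z) by (unfold q; nia).
  replace (q * Z.to_nat p)%nat with (L + (q * Z.to_nat p - L))%nat in h by lia.
  pose proof (count_from_add A (- Z.of_nat N) L (q * Z.to_nat p - L)) as [hc _].
  assert (hcount : (10 * Z.of_nat (count_in A N) <=
    (4 * p - 2 * K) * Z.of_nat q + (10 * (k + 3) + 2 * big))%Z).
  { rewrite count_in_from; fold L; lia. }
  apply IZR_le in hcount, hq.
  rewrite plus_IZR in hcount; fold D in hcount.
  rewrite !mult_IZR, minus_IZR, !mult_IZR, <- !INR_IZR_INZ in hcount.
  rewrite plus_IZR, mult_IZR, <- !INR_IZR_INZ in hq.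
  assert (hq' : INR q <= INR L / IZR p + 1).
  { apply Rmult_le_reg_r with (1 := hp0'); field_simplify; lra. }
  assert (h4 : (4 * IZR p - 2 * IZR K) * INR q <=
    (4 * IZR p - 2 * IZR K) * (INR L / IZR p + 1)).
  { apply Rmult_le_compat_l; lra. }
  replace ((2 * IZR p - IZR K) / (5 * IZR p) * INR L)
    with ((4 * IZR p - 2 * IZR K) * (INR L / IZR p) / 10) by (field; lra).
  lra.
Qed.

(** * Rotation sets *)

Definition rotation_set (t n a : Z) : Z -> bool := fun x => (t * x mod n <? a)%Z.

(** The step [d] turns the residue by [r]. From [[0, a)] this lands in [[a, n)] without wrapping
    round. *)
Lemma rotation_avoids (t n a q d r x y : Z) :
  (0 < n -> t * d = n * q + r -> a <= r <= n - a -> y = x + d ->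
   rotation_set t n a x && rotation_set t n a y = false)%Z.
Proof.
  intros hn hd hr ->; unfold rotation_set.
  destruct (Z.ltb_spec (t * x mod n) a) as [hx|]; [|reflexivity].
  apply Z.ltb_ge.
  pose proof (Z.mod_pos_bound (t * x) n hn).
  rewrite <- (Z.mod_unique (t * (x + d)) n (t * x / n + q) (t * x mod n + r)); [lia|lia|].
  pose proof (Z.div_mod (t * x) n); lia.
Qed.

Lemma rotation_independent (t n a k q1 r1 q2 r2 q3 r3 : Z) :
  (0 <= k -> 0 < n ->
   t * 1 = n * q1 + r1 -> a <= r1 <= n - a ->
   t * k = n * q2 + r2 -> a <= r2 <= n - a ->
   t * (k + 3) = n * q3 + r3 -> a <= r3 <= n - a ->
   independent [1; k; k + 3] (rotation_set t n a))%Z.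
Proof.
  intros hk hn h1 hr1 h2 hr2 h3 hr3; apply independent_sparse; [exact hk|].
  intros i j [h|[h|h]].
  - exact (rotation_avoids _ _ _ _ _ _ _ _ hn h1 hr1 h).
  - exact (rotation_avoids _ _ _ _ _ _ _ _ hn h2 hr2 h).
  - exact (rotation_avoids _ _ _ _ _ _ _ _ hn h3 hr3 h).
Qed.

(** Subtracting [a] lowers the floor exactly when the residue is below [a]. As a difference of
    floors, the indicator of a rotation set can telescope. *)
Lemma div_sub_step (u n a : Z) :
  (0 < n -> 0 <= a <= n ->
   u / n - (u - a) / n = Z.b2z (u mod n <? a))%Z.
Proof.
  intros hn ha.
  pose proof (Z.mod_pos_bound u n hn); pose proof (Z.div_mod u n).
  destruct (Z.ltb_spec (u mod n) a); simpl.
  - rewrite <- (Z.div_unique (u - a) n (u / n - 1) (u mod n - a + n)); lia.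
  - rewrite <- (Z.div_unique (u - a) n (u / n) (u mod n - a)); lia.
Qed.

(** [F] is a discrete primitive: its increments sum to at most the count of [A], while [F] stays
    within bounded distance of the line of slope [a / n]. *)
Lemma le_density_primitive (A : Z -> bool) (F : Z -> Z) (a n M : Z) :
  (0 < n)%Z ->
  (forall x, F (x + 1) - F x <= Z.b2z (A x))%Z ->
  (forall x, - M <= n * F x - a * x <= M)%Z ->
  IZR a / IZR n <= density A.
Proof.
  intros hn hF hM.
  apply le_density with (2 * IZR M / IZR n); intros N.
  assert (h : forall x L, (F (x + Z.of_nat L) - F x <= Z.of_nat (count_from A x L))%Z).
  { intros x L; induction L as [|L IH]; [rewrite Z.add_0_r; unfold count_from; simpl; lia|].
    rewrite count_from_S.
    specialize (hF (x + Z.of_nat L)%Z).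
    replace (x + Z.of_nat (S L))%Z with (x + Z.of_nat L + 1)%Z by lia; lia. }
  rewrite count_in_from.
  set (L := (2 * N + 1)%nat); set (x := (- Z.of_nat N)%Z).
  specialize (h x L).
  assert (hz : (a * Z.of_nat L <= n * Z.of_nat (count_from A x L) + 2 * M)%Z).
  { pose proof (hM x); pose proof (hM (x + Z.of_nat L)%Z); nia. }
  apply IZR_le in hz; rewrite plus_IZR, !mult_IZR, <- !INR_IZR_INZ in hz.
  apply IZR_lt in hn.
  apply Rmult_le_reg_r with (1 := hn); field_simplify; lra.
Qed.

(** Interval width and rotation step coincide, so the floor differences at consecutive [x] join end
    to end and a single floor serves as primitive. *)
Lemma rotation_density (a n : Z) :
  (0 < n)%Z -> (0 <= a <= n)%Z ->
  IZR a / IZR n <= density (rotation_set a n a).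
Proof.
  intros hn ha.
  apply le_density_primitive
    with (F := fun x => (a * (x - 1) / n)%Z) (M := (a + n)%Z); trivial; intros x.
  - unfold rotation_set; rewrite <- div_sub_step by trivial.
    replace (a * (x + 1 - 1))%Z with (a * x)%Z by ring.
    replace (a * (x - 1))%Z with (a * x - a)%Z by ring; lia.
  - pose proof (Z.mod_pos_bound (a * (x - 1)) n hn).
    pose proof (Z.div_mod (a * (x - 1)) n); lia.
Qed.

(* The points with [t x mod n < t] have density [t / n]; those with
   [t x mod n = t - 1] form the single residue class of [c]. *)
Lemma rotation_density_pred (t n c : Z) :
  (0 < t <= n)%Z ->
  (forall x, t * x mod n = t - 1 -> (x - c) mod n = 0)%Z ->
  IZR (t - 1) / IZR n <= density (rotation_set t n (t - 1)).
Proof.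
  intros ht hc; assert (hn : (0 < n)%Z) by lia.
  (* [F] counts the points of residue below [t] and takes off the class of [c], which contains every
     point of residue [t - 1]. *)
  apply le_density_primitive
    with (F := fun x => (t * (x - 1) / n - (x - 1 - c) / n)%Z)
         (M := (t + Z.abs c + 2 * n)%Z); trivial; intros x.
  - pose proof (div_sub_step (t * x) n t hn ltac:(lia)) as h1.
    pose proof (div_sub_step (x - c) n 1 hn ltac:(lia)) as h2.
    replace (t * (x + 1 - 1))%Z with (t * x)%Z by ring.
    replace (t * (x - 1))%Z with (t * x - t)%Z by ring.
    replace (x + 1 - 1 - c)%Z with (x - c)%Z by ring.
    replace (x - 1 - c)%Z with (x - c - 1)%Z by ring.
    unfold rotation_set; specialize (hc x).
    pose proof (Z.mod_pos_bound (x - c) n hn).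
    destruct (Z.ltb_spec (t * x mod n) t), (Z.ltb_spec ((x - c) mod n) 1),
      (Z.ltb_spec (t * x mod n) (t - 1)); simpl Z.b2z in *; lia.
  - pose proof (Z.mod_pos_bound (t * (x - 1)) n hn).
    pose proof (Z.div_mod (t * (x - 1)) n).
    pose proof (Z.mod_pos_bound (x - 1 - c) n hn).
    pose proof (Z.div_mod (x - 1 - c) n); lia.
Qed.

(** * The independence ratio *)

Lemma is_indep_ratio_intro (S : list Z) (r : R) (B : Z -> bool) :
  (forall A, independent S A -> density A <= r) ->
  independent S B -> r <= density B -> is_indep_ratio S r.
Proof.
  intros hup hB hlow; split.
  - intros d [A [hA ->]]; auto.
  - intros b hb; apply Rle_trans with (1 := hlow), hb; eauto.
Qed.

Theorem theorem36 (k : Z) (hk : (3 <= k)%Z) :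
  is_indep_ratio (1%Z :: k :: (k + 3)%Z :: nil)
    (let x := IZR k in
     match Z.modulo k 5 with
     | 0%Z => (2 * x + 5) / (5 * x + 20)
     | 1%Z => 2 / 5
     | 2%Z => (2 * x + 6) / (5 * x + 20)
     | 3%Z => (4 * x + 3) / (10 * x + 15)
     | _ => (2 * x + 7) / (5 * x + 20)
     end).
Proof.
  cbv zeta.
  destruct certified_potentials as [c0 [c1 [c2 [c3 c4]]]].
  assert (hx : 3 <= IZR k) by now apply IZR_le.
  pose proof (Z.mod_pos_bound k 5 ltac:(lia)) as hb.
  pose proof (Z.div_mod k 5 ltac:(lia)) as hkm.
  set (m := (k / 5)%Z) in *.
  assert (hm : (0 <= m)%Z) by lia.
  assert (hkx : IZR k = 5 * IZR m + IZR (k mod 5)).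
  { rewrite hkm at 1; now rewrite plus_IZR, mult_IZR. }
  assert (hj : (k mod 5 = 0 \/ k mod 5 = 1 \/ k mod 5 = 2 \/ k mod 5 = 3
    \/ k mod 5 = 4)%Z) by lia.
  assert (hm' : 0 <= IZR m) by now apply IZR_le.
  destruct hj as [j|[j|[j|[j|j]]]]; rewrite j in hkm, hkx |- *; clear hb j.
  - apply is_indep_ratio_intro with (rotation_set (2 * m + 1) (5 * m + 4) (2 * m + 1)).
    + intros A hA; eapply Rle_trans.
      * apply certified_density with (m := Z.to_nat m) (p := (k + 4)%Z) (k := k) (2 := hA)
          (4 := c0); lia.
      * rewrite plus_IZR; right; field; lra.
    (* Quotients and remainders of [t], [t k] and [t (k + 3)] modulo [n = k + 4]. The bound
       [2 * m + 4 <= 3 * m + 3] needs [m >= 1], which [k >= 3] gives. *)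
    + apply rotation_independent with 0%Z (2 * m + 1)%Z (2 * m - 1)%Z (2 * m + 4)%Z
        (2 * m)%Z (3 * m + 3)%Z; nia.
    + eapply Rle_trans; [|apply rotation_density; lia].
      rewrite hkx, !plus_IZR, !mult_IZR; right; field; lra.
  - apply is_indep_ratio_intro with (rotation_set 2 5 2).
    + intros A hA; eapply Rle_trans.
      * apply certified_density with (m := Z.to_nat m) (p := 1%Z) (k := k) (2 := hA)
          (4 := c1); lia.
      * lra.
    + apply rotation_independent with 0%Z 2%Z (2 * m)%Z 2%Z (2 * m + 1)%Z 3%Z; lia.
    + apply rotation_density; lia.
  - apply is_indep_ratio_intro with (rotation_set (2 * m + 2) (5 * m + 6) (2 * m + 2)).
    + intros A hA; eapply Rle_trans.
      * apply certified_density with (m := Z.to_nat m) (p := (k + 4)%Z) (k := k) (2 := hA)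
          (4 := c2); lia.
      * rewrite plus_IZR; right; field; lra.
    + apply rotation_independent with 0%Z (2 * m + 2)%Z (2 * m)%Z (2 * m + 4)%Z
        (2 * m + 1)%Z (3 * m + 4)%Z; nia.
    + eapply Rle_trans; [|apply rotation_density; lia].
      rewrite hkx, !plus_IZR, !mult_IZR; right; field; lra.
  (* Here [t k] has remainder [t - 1] modulo [n], so width [t] would admit both [0] and [k]. The
     width is cut to [t - 1], which loses the class of [k]. *)
  - apply is_indep_ratio_intro
      with (rotation_set (4 * m + 4) (10 * m + 9) (4 * m + 4 - 1)).
    + intros A hA; eapply Rle_trans.
      * apply certified_density with (m := Z.to_nat m) (p := (2 * k + 3)%Z) (k := k)
          (2 := hA) (4 := c3); lia.
      * rewrite plus_IZR, mult_IZR; right; field; lra.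
    + apply rotation_independent with 0%Z (4 * m + 4)%Z (2 * m + 1)%Z (4 * m + 3)%Z
        (2 * m + 2)%Z (6 * m + 6)%Z; nia.
    + eapply Rle_trans; [|apply rotation_density_pred with (c := k); [lia|]].
      * rewrite hkx, !minus_IZR, !plus_IZR, !mult_IZR; right; field; lra.
      * (* [k + 4] is an inverse of [t] modulo [n]: [(k + 4) t = n (2 m + 3) + 1]. *)
        intros x h.
        pose proof (Z.div_mod ((4 * m + 4) * x) (10 * m + 9) ltac:(lia)) as hd.
        rewrite h in hd.
        set (q := ((4 * m + 4) * x / (10 * m + 9))%Z) in *.
        apply Z.mod_divide; [lia|].
        (* Found by multiplying [t x = n q + t - 1] by the inverse [k + 4] and using
           [n = 2 k + 3]. *)
        exists ((k + 4) * q - (2 * m + 3) * x + (2 * m + 2))%Z.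
        assert (hinv : ((k + 4) * (4 * m + 4) = (10 * m + 9) * (2 * m + 3) + 1)%Z)
          by (rewrite hkm; ring).
        apply (f_equal (Z.mul (k + 4))) in hd.
        rewrite Z.mul_assoc, hinv in hd; rewrite hkm in hd |- *; lia.
  - apply is_indep_ratio_intro with (rotation_set (2 * m + 3) (5 * m + 8) (2 * m + 3)).
    + intros A hA; eapply Rle_trans.
      * apply certified_density with (m := Z.to_nat m) (p := (k + 4)%Z) (k := k) (2 := hA)
          (4 := c4); lia.
      * rewrite plus_IZR; right; field; lra.
    + apply rotation_independent with 0%Z (2 * m + 3)%Z (2 * m + 1)%Z (2 * m + 4)%Z
        (2 * m + 2)%Z (3 * m + 5)%Z; nia.
    + eapply Rle_trans; [|apply rotation_density; lia].
      rewrite hkx, !plus_IZR, !mult_IZR; right; field; lra.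
Qed.
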